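(* Let $H$ be a real Hilbert space, $C\subset H$ nonempty closed convex with metric projection $P$, and $A,F:H\to H$ satisfying: (A1) $A$ is $\lambda$-strongly monotone and $L_A$-Lipschitz continuous, $F$ is $L_F$-Lipschitz continuous, and $A,F$ are sequentially weak-to-weak continuous; (A2) the couple $(A,F)$ is monotone; (A3) $\mathrm{Sol}(A,F,C)\neq\emptyset$ and $A(\mathrm{Sol}(A,F,C))$ is convex. Let $\alpha,\mu:[0,\infty)\to(0,\infty)$ be continuous functions. Then for every $x_0\in H$ the Cauchy problem $$\dot x(t)=P\big(F_{\alpha(t)}x(t)-\mu(t)Ax(t)\big)-F_{\alpha(t)}x(t),\qquad x(0)=x_0,$$ where $F_{\alpha}:=F+\alpha I$, admits a unique strong global solution.
   Context: $\mathrm{Sol}(A,F,C)$ is the solution set of $\mathrm{GVI}(A,F,C)$: find $x^*\in H$ with $Fx^*\in C$ and $\langle Ax^*,y-Fx^*\rangle\ge0$ for all $y\in C$. The couple $(A,F)$ is monotone if $\langle Ax-Ay,Fx-Fy\rangle\ge0$ for all $x,y$. Sequentially weak-to-weak continuous: $x^k\rightharpoonup\bar x$ implies $Ax^k\rightharpoonup A\bar x$. A strong global solution is a function $x:[0,\infty)\to H$ that is absolutely continuous on every interval $[0,T]$, $T<\infty$, satisfies the differential equation for almost every $t\ge0$, and satisfies $x(0)=x_0$. *)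

(* Defs.v *)
From HB Require Import structures.
From mathcomp Require Import all_boot all_order all_algebra.
From mathcomp Require Import all_classical all_reals all_analysis.
Set Implicit Arguments. Unset Strict Implicit. Unset Printing Implicit Defensive.
Import Order.TTheory GRing.Theory Num.Theory.
Import numFieldNormedType.Exports.
Local Open Scope classical_set_scope.
Local Open Scope ring_scope.

(* A real Hilbert space: a complete normed space (completeNormedModType R)
   whose norm comes from an inner product ip. *)
Record inner_product (R : realType) (H : normedModType R) (ip : H -> H -> R)
  : Prop := InnerProduct {
  ip_sym : forall x y, ip x y = ip y x;
  ip_linearl : forall (a : R) x y z, ip (a *: x + y) z = a * ip x z + ip y z;
  ip_norm : forall x, `|x| ^+ 2 = ip x x
}.

Section Defs.
Context {R : realType} {H : normedModType R}.

Definition metric_projection (C : set H) (P : H -> H) : Prop :=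
  forall x, C (P x) /\ forall y, C y -> `|x - P x| <= `|x - y|.

Definition strongly_monotone (ip : H -> H -> R) (lam : R) (A : H -> H) : Prop :=
  forall x y, lam * `|x - y| ^+ 2 <= ip (A x - A y) (x - y).

Definition lipschitz_with (L : R) (A : H -> H) : Prop :=
  forall x y, `|A x - A y| <= L * `|x - y|.

Definition weak_cvg (ip : H -> H -> R) (u : nat -> H) (x : H) : Prop :=
  forall y, (fun k => ip (u k) y) @ \oo --> ip x y.

Definition seq_weak_weak_continuous (ip : H -> H -> R) (A : H -> H) : Prop :=
  forall (u : nat -> H) x, weak_cvg ip u x -> weak_cvg ip (A \o u) (A x).

Definition couple_monotone (ip : H -> H -> R) (A F : H -> H) : Prop :=
  forall x y, 0 <= ip (A x - A y) (F x - F y).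

Definition GVI_sol (ip : H -> H -> R) (A F : H -> H) (C : set H) : set H :=
  [set x | C (F x) /\ forall y, C y -> 0 <= ip (A x) (y - F x)].

Definition abs_cont_on (x : R -> H) (a b : R) : Prop :=
  forall e : R, 0 < e -> exists2 d : R, 0 < d &
    forall (n : nat) (s t : 'I_n -> R),
      (forall i, a <= s i /\ s i <= t i /\ t i <= b) ->
      (forall i j, i != j -> t i <= s j \/ t j <= s i) ->
      \sum_(i < n) (t i - s i) < d ->
      \sum_(i < n) `|x (t i) - x (s i)| < e.

Definition strong_global_solution (G : R -> H -> H) (x0 : H) (x : R -> H) : Prop :=
  [/\ forall T, 0 <= T -> abs_cont_on x 0 T,
      {ae (@lebesgue_measure R), forall t, 0 <= t ->
          derivable x t 1 /\ 'D_1 x t = G t (x t)}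
    & x 0 = x0].

End Defs.

(* Main.v *)
(** The metric projection onto a convex set is nonexpansive, so the right-hand
    side of the equation is Lipschitz in [x], with a constant [L t] that is
    continuous in [t], and the Picard iteration applies.

    Integrals of [H]-valued functions are avoided: a continuous function has an
    antiderivative (a limit of Riemann sums), and increments are estimated by the
    mean value inequality.  If [W' = 2 L W], a bound [B W] on the difference of
    two functions becomes [B W / 2] after one Picard step; on the whole half-line
    this gives the convergence of the iterates, and the same halving gives
    uniqueness.  Uniqueness for absolutely continuous solutions needs the mean
    value inequality with a derivative bound only almost everywhere: the
    exceptional null set is covered by an open set of small measure, on which
    absolute continuity controls the increments. *)

Require Import Defs.
From HB Require Import structures.
From mathcomp Require Import all_boot all_order all_algebra.
From mathcomp Require Import all_classical all_reals all_analysis.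
From mathcomp Require Import measurable_realfun ring lra.
Import Order.TTheory GRing.Theory Num.Theory.
Import numFieldNormedType.Exports.
Local Open Scope classical_set_scope.
Local Open Scope ring_scope.

Set Implicit Arguments.
Unset Strict Implicit.

(** * Continuous induction, derivatives over straddling segments, limits *)

Lemma subrACA (V : zmodType) (a b c d : V) : (a - b) - (c - d) = (a - c) - (b - d).
Proof. by rewrite !opprB addrACA [RHS]addrACA [- b - c]addrC. Qed.

(** With [c] the supremum of the points of [[a, b]] where [Q] holds, a good point just left of [c]
    passes [Q] to [b] or to [c + d / 2], and the latter contradicts the choice of [c]. Since
    [s <= c <= t], each step needs only local information at the one point [c]. *)
Lemma continuous_induction (R : realType) (Q : R -> Prop) (a b : R) :
  a <= b -> Q a ->
  (forall c, a <= c <= b -> exists2 d, 0 < d & forall s t,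
     a <= s -> s <= c -> c <= t -> t <= b -> c - d < s -> t < c + d ->
     Q s -> Q t) ->
  Q b.
Proof.
move=> ab Qa step.
pose S := [set t | a <= t <= b /\ Q t].
have Sa : S a by split => //; rewrite lexx ab.
have hS : has_sup S.
  by split; [exists a | exists b => t [/andP[]]].
set c := sup S.
have ac : a <= c by apply: ub_le_sup => //; case: hS.
have cb : c <= b by apply: ge_sup; [exists a | move=> t [/andP[]]].
have [|d d0 hd] := step c; first by rewrite ac cb.
have [s [/andP[sa sb] Qs] cs] := sup_adherent d0 hS.
have sc : s <= c by apply: ub_le_sup; [case: hS | split => //; rewrite sa sb].
have [bc|bc] := leP b (c + d / 2).
  by apply: (hd s b) => //; lra.
have : c + d / 2 <= c.
  apply: ub_le_sup; first by case: hS.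
  split; first lra.
  by apply: (hd s) => //; lra.
lra.
Qed.

(** The remainders at [s] and [t] subtract, and their errors add up because
    [|t - c| + |s - c| = t - s] when [c] lies in between; conversely take [s = c] or [t = c]. This
    is the form of differentiability that fits continuous induction. *)
Lemma is_derive_segmentP (R : realType) (V : normedModType R) (f : R -> V)
    (c : R) (v : V) :
  is_derive c 1 f v <->
  (forall e, 0 < e -> exists2 d, 0 < d & forall s t, s <= c -> c <= t ->
     c - d < s -> t < c + d -> `|f t - f s - (t - s) *: v| <= e * (t - s)).
Proof.
split=> [[fc fv] e e0|h].
  have /cvgrPdist_le /(_ _ e0) /nbhs_ballP[d /= d0 hd] :
      (fun h => h^-1 *: ((f \o shift c) (h *: 1) - f c)) @ 0^' --> v.
    by rewrite -fv; exact: fc.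
  have H u : `|u - c| < d -> `|f u - f c - (u - c) *: v| <= e * `|u - c|.
    move=> ucd; have [->|uc] := eqVneq u c.
      by rewrite !subrr scale0r subrr !normr0 mulr0.
    have uc0 : u - c != 0 by rewrite subr_eq0.
    have /= := hd (u - c).
    rewrite /ball /= sub0r normrN => /(_ ucd uc0).
    rewrite [_ *: 1]mulr1 subrK => uv.
    rewrite -[f u - f c](scalerKV uc0) -scalerBr normrZ mulrC.
    by rewrite ler_wpM2r ?normr_ge0// distrC.
  exists d => // s t sc ct cs td.
  have Hs := H s _; rewrite ler0_norm ?subr_le0// in Hs.
  have Ht := H t _; rewrite ger0_norm ?subr_ge0// in Ht.
  have -> : f t - f s - (t - s) *: v =
      (f t - f c - (t - c) *: v) - (f s - f c - (s - c) *: v).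
    rewrite subrACA -scalerBl; congr (_ - _ *: _); last by ring.
    by rewrite opprB addrA subrK.
  rewrite (le_trans (ler_normB _ _))//.
  have : e * (t - s) = e * (t - c) + e * - (s - c) by ring.
  by move=> ->; rewrite lerD ?Ht ?Hs//; lra.
suff h' : (fun h => h^-1 *: ((f \o shift c) (h *: 1) - f c)) @ 0^' --> v.
  by split; [apply/cvg_ex; exists v | exact/cvg_lim].
apply/cvgrPdist_le => e e0; have [d d0 hd] := h e e0.
apply/nbhs_ballP; exists d => //= u; rewrite /ball /= sub0r normrN => ud u0.
rewrite [_ *: 1]mulr1.
have -> : v - u^-1 *: (f (u + c) - f c) = u^-1 *: (u *: v - (f (u + c) - f c)).
  by rewrite [RHS]scalerBr scalerK.
rewrite normrZ normfV ler_pdivrMl ?normr_gt0// distrC mulrC.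
have [u_ge0|u_lt0] := leP 0 u.
  have := hd c (u + c); rewrite addrK ger0_norm//.
  rewrite ger0_norm// in ud.
  by apply; lra.
have := hd (u + c) c; rewrite opprD addrCA subrr addr0 ltr0_norm//.
rewrite ltr0_norm// in ud.
rewrite -normrN scaleNr opprK !opprD opprK.
rewrite [- f c + _]addrC.
by apply; lra.
Qed.

Lemma cauchy_seq_cvg (R : realType) (V : completeNormedModType R)
    (u : nat -> V) :
  (forall e, 0 < e -> exists N, forall n m, (N <= n)%N -> (N <= m)%N ->
     `|u n - u m| <= e) ->
  exists l : V, u @ \oo --> l.
Proof.
move=> h; apply/cvg_ex/cauchy_cvgP/cauchy_exP => e e0.
have [N hN] := h (e / 2) ltac:(lra).
exists (u N); exists N => // n /= Nn.
rewrite -ball_normE /=.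
by apply: le_lt_trans (hN _ _ (leqnn N) Nn) _; lra.
Qed.

Lemma cvg_dist_le (R : realType) (V : normedModType R) (u : nat -> V) (l w : V)
    (e : R) (N : nat) :
  u @ \oo --> l -> (forall n, (N <= n)%N -> `|u n - w| <= e) -> `|l - w| <= e.
Proof.
move=> ul h; have ulw : (fun n => `|u n - w|) @ \oo --> `|l - w|.
  by apply: cvg_norm; apply: cvgB => //; exact: cvg_cst.
by apply: (ler_cvg_to ulw (cvg_cst e)); exists N.
Qed.

(** * Riemann sums and antiderivatives of vector-valued functions *)

Section riemann_sum.
Context {R : realType} {V : normedModType R} (f : R -> V).

(* The points [grid n 0 < ... < grid n (2 (n+1)^2)] subdivide [[-(n+1), n+1]]
   with mesh [1/(n+1)]. *)
Definition grid (n k : nat) : R := k%:R / n.+1%:R - n.+1%:R.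

(** Length of the part of the [k]-th cell that lies to the left of [t]. *)
Definition grid_weight n t k : R :=
  Order.min t (grid n k.+1) - Order.min t (grid n k).

(** A left-endpoint sum from [-(n+1)] up to [t]. One grid serves all [t], the cell containing [t]
    being cut there, so that increments over adjacent intervals simply add. *)
Definition riemann_sum n t : V :=
  \sum_(0 <= k < 2 * (n.+1 * n.+1)) grid_weight n t k *: f (grid n k).

Lemma gridS n k : grid n k.+1 = grid n k + n.+1%:R^-1.
Proof. by rewrite /grid -addn1 natrD mulrDl mul1r addrAC. Qed.

Lemma grid_weight_incr n s t k : s <= t -> grid_weight n s k <= grid_weight n t k.
Proof.
move=> st; rewrite /grid_weight gridS; have := invr_ge0 (n.+1%:R : R).
rewrite ler0n => h; set h' := n.+1%:R^-1 in h *; set p := grid n k.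
rewrite /Order.min; case: ifP => ?; case: ifP => ?; case: ifP => ?; case: ifP => ?; lra.
Qed.

Lemma grid_weight_cst n s t k : s <= t -> t <= grid n k \/ grid n k.+1 <= s ->
  grid_weight n s k = grid_weight n t k.
Proof.
move=> st; rewrite /grid_weight gridS; have := invr_ge0 (n.+1%:R : R).
rewrite ler0n => h; set h' := n.+1%:R^-1 in h *; set p := grid n k.
rewrite !minEle => -[tp|ps];
  case: leP => ?; case: leP => ?; case: leP => ?; case: leP => ?; lra.
Qed.

Lemma sum_grid_weight n t : - n.+1%:R <= t <= n.+1%:R ->
  \sum_(0 <= k < 2 * (n.+1 * n.+1)) grid_weight n t k = t + n.+1%:R.
Proof.
move=> /andP[h1 h2]; rewrite (telescope_sumr (fun k => Order.min t (grid n k)))//.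
have -> : grid n (2 * (n.+1 * n.+1)) = n.+1%:R.
  rewrite /grid !natrM; have : (n.+1%:R : R) != 0 by rewrite pnatr_eq0.
  by move: n.+1%:R => x x0; field.
rewrite min_l// min_r; last by rewrite /grid mul0r sub0r.
by rewrite /grid mul0r sub0r opprK.
Qed.

(** Only cells that meet []s, t[] change weight between [s] and [t]; the changes are nonnegative and
    sum to [t - s]. The left endpoint of such a cell may precede [s] by up to one mesh, hence the
    margin in the hypothesis on [f]. *)
Lemma riemann_sum_dist n s t v e :
  s <= t -> - n.+1%:R <= s -> t <= n.+1%:R ->
  (forall u, s - n.+1%:R^-1 <= u -> u <= t -> `|f u - v| <= e) ->
  `|riemann_sum n t - riemann_sum n s - (t - s) *: v| <= e * (t - s).
Proof.
move=> st hs ht hv.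
have -> : t - s = \sum_(0 <= k < 2 * (n.+1 * n.+1))
    (grid_weight n t k - grid_weight n s k).
  rewrite sumrB !sum_grid_weight; [lra|lra|lra].
rewrite scaler_suml mulr_sumr /riemann_sum -!sumrB.
apply: le_trans (ler_norm_sum _ _ _) _.
apply: ler_sum => k _; rewrite -scalerBl -scalerBr normrZ.
have [tk|kt] := leP t (grid n k).
  by rewrite (grid_weight_cst st) ?subrr ?normr0 ?mul0r ?mulr0//; left.
have [ks|sk] := leP (grid n k.+1) s.
  by rewrite (grid_weight_cst st) ?subrr ?normr0 ?mul0r ?mulr0//; right.
rewrite ger0_norm ?subr_ge0 ?grid_weight_incr// mulrC.
rewrite ler_wpM2r ?subr_ge0 ?grid_weight_incr//.
by apply: hv; [rewrite lerBlDr -gridS|]; exact: ltW.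
Qed.

Lemma riemann_sum_near c : {for c, continuous f} -> forall e, 0 < e ->
  exists2 d, 0 < d & exists N, forall n, (N <= n)%N -> forall s t,
    c - d < s -> s <= t -> t < c + d ->
    `|riemann_sum n t - riemann_sum n s - (t - s) *: f c| <= e * (t - s).
Proof.
move=> /cvgrPdist_le fc e e0; have /nbhs_ballP[d /= d0 hd] := fc e e0.
exists (d / 2); first lra.
(* For such [n] the mesh is below [d / 2] and the grid covers [[c - d, c + d]]. *)
exists (Num.trunc (2 / d + `|c| + d)) => n Nn s t cs st tc.
have : (2 / d + `|c| + d) < n.+1%:R.
  by rewrite -truncn_le_nat.
set x := n.+1%:R => hx.
have d20 : 0 < 2 / d by rewrite divr_gt0.
have c0 := normr_ge0 c.
have /andP[c1 c2] : - `|c| <= c <= `|c| by rewrite -ler_norml.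
have x0 : 0 < x by lra.
have hd2 : x^-1 < d / 2.
  by rewrite -[ltRHS]invrK ltf_pV2 ?posrE ?invr_gt0 ?divr_gt0// invf_div; lra.
apply: riemann_sum_dist => //; rewrite -?/x; [lra|lra|].
move=> u su ut; rewrite distrC; apply: hd.
by rewrite -ball_normE /= ltr_distl; move: (x^-1) hd2 su => y hd2 su; lra.
Qed.

(** Near [c] the increments of both sums are within [e / 2 * (t - s)] of [(t - s) *: f c].
    Continuous induction collects the thresholds [N] along [[a, b]], in place of uniform
    continuity. *)
Lemma riemann_sum_cauchy : continuous f -> forall a b, a <= b ->
  forall e, 0 < e -> exists N, forall n m, (N <= n)%N -> (N <= m)%N ->
    `|(riemann_sum n b - riemann_sum n a) - (riemann_sum m b - riemann_sum m a)|
      <= e * (b - a).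
Proof.
move=> fc a b ab e e0.
pose Q t := exists N, forall n m, (N <= n)%N -> (N <= m)%N ->
  `|(riemann_sum n t - riemann_sum n a) - (riemann_sum m t - riemann_sum m a)|
    <= e * (t - a).
apply: (@continuous_induction _ Q a b) => //.
  by exists 0%N => n m _ _; rewrite !subrr normr0 mulr0.
move=> c acb; have [d d0 [N hN]] := @riemann_sum_near c (fc c) (e / 2) ltac:(lra).
exists d => // s t _ sc ct _ cs tc [M hM].
exists (maxn N M) => n m; rewrite !geq_max => /andP[Nn Mn] /andP[Nm Mm].
have hn := hN n Nn s t cs (le_trans sc ct) tc.
have hm := hN m Nm s t cs (le_trans sc ct) tc.
have hnm := hM n m Mn Mm.
have dec k : riemann_sum k t - riemann_sum k a =
    riemann_sum k s - riemann_sum k a +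
    ((riemann_sum k t - riemann_sum k s - (t - s) *: f c) + (t - s) *: f c).
  by rewrite subrK [RHS]addrC addrA subrK.
rewrite (dec n) (dec m) opprD addrACA [in X in _ + X]opprD [X in _ + X]addrACA.
rewrite subrr addr0 (le_trans (ler_normD _ _))//.
have -> : e * (t - a) = e * (s - a) + (e / 2 * (t - s) + e / 2 * (t - s)) by field.
by apply: lerD => //; rewrite (le_trans (ler_normB _ _))// lerD.
Qed.

End riemann_sum.

(** In [riemann_sum_near] the radius [d] does not depend on [n], so the estimate passes to the limit
    and becomes the segment form of differentiability. *)
Lemma antiderivative (R : realType) (V : completeNormedModType R) (f : R -> V) :
  continuous f ->
  exists2 F : R -> V, F 0 = 0 & forall t : R, is_derive t 1 F (f t).
Proof.
move=> fc.
have /choice[F hF] t : exists l : V,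
    (fun n => riemann_sum f n t - riemann_sum f n 0) @ \oo --> l.
  apply: cauchy_seq_cvg => e e0.
  have h a b : a <= b -> exists N, forall n m, (N <= n)%N -> (N <= m)%N ->
      `|(riemann_sum f n b - riemann_sum f n a) -
        (riemann_sum f m b - riemann_sum f m a)| <= e.
    move=> ab; have ba1 : 0 < b - a + 1 by lra.
    have [N hN] := riemann_sum_cauchy fc ab (divr_gt0 e0 ba1).
    exists N => n m Nn Nm; apply: le_trans (hN n m Nn Nm) _.
    by rewrite mulrAC ler_pdivrMr// ler_wpM2l//; lra.
  have [t0|/ltW t0] := leP 0 t; first exact: h.
  have [N hN] := h _ _ t0; exists N => n m Nn Nm.
  have := hN m n Nm Nn.
  by rewrite -(opprB (riemann_sum f m t)) -(opprB (riemann_sum f n t)) opprK addrC.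
exists F.
  have h0 : (fun n => riemann_sum f n 0 - riemann_sum f n 0) @ \oo --> (0 : V).
    rewrite (_ : (fun _ => _) = fun=> 0); first exact: cvg_cst.
    by apply/funext => n; rewrite subrr.
  by apply: cvg_unique h0 => //; exact: hF.
move=> c; apply/is_derive_segmentP => e e0.
have [d d0 [N hN]] := riemann_sum_near (fc c) e0.
exists d => // s t sc ct cs tc.
apply: (@cvg_dist_le _ _ (fun n => (riemann_sum f n t - riemann_sum f n 0) -
    (riemann_sum f n s - riemann_sum f n 0)) _ _ _ N).
  exact: cvgB.
move=> n Nn; rewrite opprB addrA subrK; apply: hN => //; exact: le_trans ct.
Qed.

(** * Mean value inequalities, everywhere and almost everywhere *)

Section mean_value_inequality.
Context {R : realType} {V : normedModType R}.
Implicit Types (z : R -> V) (g : R -> R).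

Lemma is_derive_dist_le z g (c : R) v w e :
  is_derive c 1 z v -> is_derive c 1 g w -> `|v| <= w -> 0 < e ->
  exists2 d, 0 < d & forall s t, s <= c -> c <= t -> c - d < s -> t < c + d ->
    `|z t - z s| <= g t - g s + e * (t - s).
Proof.
move=> /is_derive_segmentP zv /is_derive_segmentP gw vw e0.
have [d1 d10 h1] := zv (e / 2) ltac:(lra).
have [d2 d20 h2] := gw (e / 2) ltac:(lra).
exists (Order.min d1 d2); first by rewrite lt_min d10.
move=> s t sc ct; rewrite ltrBlDr -ltrBlDl lt_min -ltrBlDl lt_min.
move=> /andP[a1 a2] /andP[a3 a4].
have st : s <= t by exact: le_trans ct.
have {h1} := h1 s t sc ct ltac:(lra) ltac:(lra).
have {h2} := h2 s t sc ct ltac:(lra) ltac:(lra).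
rewrite ler_distl => /andP[h2 _] h1.
have -> : z t - z s = (z t - z s - (t - s) *: v) + (t - s) *: v by rewrite subrK.
rewrite (le_trans (ler_normD _ _))// normrZ ger0_norm ?subr_ge0//.
have : (t - s) * `|v| <= (t - s) * w by rewrite ler_wpM2l// subr_ge0.
by move: h2; have -> : (t - s) *: w = (t - s) * w by []; lra.
Qed.

(** The local errors are absorbed by a slack [h * (t - a)] that grows with [t] along the continuous
    induction; [h] keeps the total below [e]. *)
Lemma mean_value_le z g (z' : R -> V) (g' : R -> R) (a b : R) : a <= b ->
  (forall t : R, a <= t <= b -> is_derive t 1 z (z' t)) ->
  (forall t : R, a <= t <= b -> is_derive t 1 g (g' t)) ->
  (forall t : R, a <= t <= b -> `|z' t| <= g' t) ->
  `|z b - z a| <= g b - g a.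
Proof.
move=> ab hz hg hzg; apply/ler_addgt0Pr => e e0.
have ba1 : 0 < b - a + 1 by lra.
pose h := e / (b - a + 1); have h0 : 0 < h by rewrite divr_gt0.
have he : h * (b - a) <= e by rewrite mulrAC ler_pdivrMr// ler_wpM2l//; lra.
suff : `|z b - z a| <= g b - g a + h * (b - a) by move=> ?; lra.
pose Q t := `|z t - z a| <= g t - g a + h * (t - a).
apply: (@continuous_induction _ Q a b) => //; first by rewrite /Q !subrr normr0 mulr0 addr0.
move=> c acb; have [d d0 hd] := is_derive_dist_le (hz c acb) (hg c acb) (hzg c acb) h0.
exists d => // s t _ sc ct _ cs td; rewrite /Q => Qs.
have -> : z t - z a = (z t - z s) + (z s - z a) by rewrite addrA subrK.
rewrite (le_trans (ler_normD _ _))//.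
have := hd s t sc ct cs td; lra.
Qed.

(** Lists ordered from the latest interval to the earliest let an induction on time add an interval
    by a mere cons. *)
Lemma abs_cont_on_seq z a b : abs_cont_on z a b ->
  forall e, 0 < e -> exists2 d : R, 0 < d & forall l : seq (R * R),
    all (fun p => [&& a <= p.1, p.1 <= p.2 & p.2 <= b]) l ->
    pairwise (fun p q => q.2 <= p.1) l ->
    \sum_(p <- l) (p.2 - p.1) < d -> \sum_(p <- l) `|z p.2 - z p.1| < e.
Proof.
move=> zac e e0; have [d d0 hd] := zac e e0; exists d => // l lab lpw.
rewrite !(big_nth (0, 0)) !big_mkord => ld.
apply: (hd _ (fun i : 'I_(size l) => (nth (0, 0) l i).1)
  (fun i : 'I_(size l) => (nth (0, 0) l i).2)) => //.
  by move=> i; have /and3P[] := all_nthP (0, 0) lab i (ltn_ord i).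
move=> i j ij; have /orP[ltij|ltji] : (i < j)%N || (j < i)%N by rewrite -neq_ltn.
  by right; apply: (pairwiseP (0, 0) lpw) => //; rewrite inE.
by left; apply: (pairwiseP (0, 0) lpw) => //; rewrite inE.
Qed.

(** Outer regularity of Lebesgue measure, applied to a measurable null set containing the
    exceptions. *)
Lemma ae_open_cover (P : R -> Prop) (d : R) : 0 < d ->
  {ae (@lebesgue_measure R), forall t, P t} ->
  exists U : set R, [/\ open U, forall t, ~ P t -> U t &
    (lebesgue_measure U < d%:E)%E].
Proof.
move=> d0 [A [mA A0 PA]].
have [|U [oU AU Ud]] := lebesgue_regularity_outer mA _ d0.
  by rewrite [X in (X < _)%E]A0 ltry.
exists U; split => // [t nPt|]; first by apply: AU; exact: PA.
have mU : measurable U by exact: open_measurable.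
rewrite [X in (X < _)%E](measureDI lebesgue_measure mU mA).
rewrite [X in (_ + X)%E](_ : _ = 0%E) ?adde0//.
apply/eqP; rewrite eq_le measure_ge0 andbT -[leRHS]A0.
by apply: le_measure; rewrite ?inE//; exact: measurableI.
Qed.

(** At a point [c] outside the open cover [U] the derivative bound advances the estimate. At [c] in
    [U] the whole segment [[s, t]] lies in [U] and joins the list. The listed lengths total less
    than [d], so absolute continuity keeps their increments below [e / 2]. *)
Lemma mean_value_ae_le z g (g' : R -> R) (T : R) : 0 <= T ->
  abs_cont_on z 0 T ->
  (forall t : R, 0 <= t <= T -> is_derive t 1 g (g' t)) ->
  (forall t : R, 0 <= t <= T -> 0 <= g' t) ->
  {ae (@lebesgue_measure R), forall t : R, 0 <= t <= T ->
     derivable z t 1 /\ `|'D_1 z t| <= g' t} ->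
  `|z T - z 0| <= g T - g 0.
Proof.
move=> T0 zac hg g'0 zae; apply/ler_addgt0Pr => e e0.
have T1 : 0 < T + 1 by lra.
pose h := e / 2 / (T + 1); have h0 : 0 < h by rewrite !divr_gt0.
have he : h * T <= e / 2 by rewrite mulrAC ler_pdivrMr// ler_wpM2l//; lra.
have [d d0 hd] := abs_cont_on_seq zac (e := e / 2) ltac:(lra).
have [U [oU nU Ud]] := ae_open_cover d0 zae.
have mU : measurable U by exact: open_measurable.
pose mu := @lebesgue_measure R.
(* [l] collects, latest first, the intervals on which the increment of [z] is
   bounded through absolute continuity instead of the derivative. *)
pose Q t := exists l : seq (R * R), [/\
  all (fun p => [&& 0 <= p.1, p.1 <= p.2 & p.2 <= t]) l,
  pairwise (fun p q => q.2 <= p.1) l,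
  ((\sum_(p <- l) (p.2 - p.1))%:E <= mu (U `&` `[0%R, t[%classic))%E &
  `|z t - z 0| <= g t - g 0 + h * t + \sum_(p <- l) `|z p.2 - z p.1|].
have mUI t : measurable (U `&` `[0%R, t[%classic) by exact: measurableI.
suff [l [l0 lpw lU lz]] : Q T.
  have hS : \sum_(p <- l) `|z p.2 - z p.1| < e / 2.
    apply: hd => //; rewrite -lte_fin; apply: le_lt_trans lU _.
    apply: le_lt_trans Ud; apply: le_measure; rewrite ?inE//.
    exact: mUI.
  apply: le_trans lz _; rewrite -addrA lerD2l.
  by apply: le_trans (lerD he (ltW hS)) _; lra.
apply: (@continuous_induction _ Q 0 T) => //.
  exists [::]; split => //; first by rewrite big_nil measure_ge0.
  by rewrite big_nil !subrr normr0 mulr0 !addr0.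
move=> c c0T.
have [Uc|nUc] := pselect (U c).
  have /nbhs_ballP[d1 /= d10 hd1] : nbhs c U by exact: open_nbhs_nbhs.
  (* Comparing the zero function with [g] yields [0 <= g t - g s + h * (t - s)]: the bound on [z]
     does not shrink while [[s, t]] goes to the list. *)
  have [d2 d20 hd2] := @is_derive_dist_le (cst 0) g c 0 _ h (is_derive_cst _ _ _)
    (hg c c0T) ltac:(by rewrite normr0 g'0) h0.
  exists (Order.min d1 d2); first by rewrite lt_min d10.
  move=> s t s0 sc ct tT; rewrite ltrBlDr -ltrBlDl lt_min -ltrBlDl lt_min.
  move=> /andP[a1 a2] /andP[a3 a4] [l [l0 lpw lU lz]].
  have st : s <= t by exact: le_trans ct.
  have := hd2 s t sc ct ltac:(lra) ltac:(lra).
  rewrite subrr normr0 => gst.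
  exists ((s, t) :: l); split => /=.
  - rewrite s0 st lexx /=; apply: sub_all l0 => p /and3P[-> -> /=] ps.
    exact: le_trans st.
  - by rewrite lpw andbT; apply: sub_all l0 => p /and3P[].
  - rewrite big_cons /= EFinD.
    have -> : (t - s)%:E = mu `[s, t[%classic.
      rewrite /mu lebesgue_measure_itv /= lte_fin; case: ltP => //.
      by move=> ts; have -> : t = s; [lra | rewrite subrr].
    (* Half-open intervals make [[s, t[] disjoint from the part of [U] in [[0, s[]; both lie in the
       part of [U] in [[0, t[], so their measures add. *)
    rewrite addeC; apply: le_trans (leeD lU (lexx _)) _.
    have mst : measurable (`[s, t[%classic : set R) by exact: measurable_itv.
    rewrite -measureU; [|exact: mUI|exact: mst|]; last first.
      apply/seteqP; split => // u [[_]] /=; rewrite !in_itv /=.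
      by move=> /andP[_ us] /andP[su _]; lra.
    apply: le_measure; rewrite ?inE.
    - exact: measurableU (mUI s) mst.
    - exact: mUI.
    move=> u [[Uu]|] /=; rewrite !in_itv /= => /andP[u1 u2].
      by split => //; rewrite u1 /=; lra.
    split; last by lra.
    by apply: hd1; rewrite -ball_normE /= ltr_distl; lra.
  - rewrite big_cons /=.
    have -> : z t - z 0 = (z t - z s) + (z s - z 0) by rewrite addrA subrK.
    rewrite (le_trans (ler_normD _ _))//; lra.
have [zc zg] : derivable z c 1 /\ `|'D_1 z c| <= g' c.
  by apply: contrapT => hc; apply: nUc; apply: nU => /(_ c0T).
have [d1 d10 hd1] := is_derive_dist_le (derivableP zc) (hg c c0T) zg h0.
exists d1 => // s t s0 sc ct tT cs td [l [l0 lpw lU lz]].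
have st : s <= t by exact: le_trans ct.
exists l; split => //.
- by apply: sub_all l0 => p /and3P[-> -> /=] ps; exact: le_trans st.
- apply: le_trans lU _; apply: le_measure; rewrite ?inE; [exact: mUI|exact: mUI|].
  by apply: setIS => u /=; rewrite !in_itv /= => /andP[-> us]; exact: lt_le_trans st.
- have -> : z t - z 0 = (z t - z s) + (z s - z 0) by rewrite addrA subrK.
  rewrite (le_trans (ler_normD _ _))//.
  have := hd1 s t sc ct cs td; lra.
Qed.

End mean_value_inequality.

(** * Weighted Picard iteration and global existence *)

Lemma is_derive_continuous (R : realType) (V : normedModType R) (f : R -> V)
    (t : R) (v : V) :
  is_derive t 1 f v -> {for t, continuous f}.
Proof. by move=> [df _]; apply/differentiable_continuous/derivable1_diffP. Qed.

Lemma continuous_max0 (R : realType) : continuous (Order.max 0 : R -> R).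
Proof.
move=> t; rewrite /continuous_at.
by apply: (@continuous_max R R (cst 0) id t); [exact: cvg_cst | exact: cvg_id].
Qed.

Lemma geometric_le (R : realType) (C e : R) : 0 <= C -> 0 < e ->
  exists N, forall n, (N <= n)%N -> C * 2^-1 ^+ n <= e.
Proof.
move=> C0 e0; have : (GRing.exp (2^-1 : R) : nat -> R) @ \oo --> (0 : R).
  by apply: cvg_expr; rewrite ger0_norm; lra.
move=> /cvgrPdist_le /(_ (e / (C + 1)) ltac:(by rewrite divr_gt0//; lra))[N _ hN].
exists N => n /hN /=; rewrite sub0r normrN.
have y0 : 0 <= (2^-1 : R) ^+ n by rewrite exprn_ge0//; lra.
rewrite ger0_norm// ler_pdivlMr; last lra.
by apply: le_trans; rewrite mulrC ler_wpM2l//; lra.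
Qed.

(** [W] is the exponential of the antiderivative of [2 * M] vanishing at 0, which is nonnegative for
    [t >= 0]. The factor 2 is what makes each Picard step halve a bound proportional to [W]. *)
Lemma picard_weight (R : realType) (M : R -> R) :
  continuous M -> (forall t, 0 <= M t) ->
  exists W : R -> R, [/\ forall t, 0 <= W t, forall t, 0 <= t -> 1 <= W t &
    forall t : R, is_derive t 1 W (2 * M t * W t)].
Proof.
move=> Mc M0; have [|/= N N0 hN] := @antiderivative R R (fun t => 2 * M t).
  by move=> t; apply: cvgM; [exact: cvg_cst | exact: Mc].
have dW t : is_derive (t : R) 1 (expR \o N) (2 * M t * (expR \o N) t).
  by rewrite mulrC; apply: is_derive1_comp.
exists (expR \o N); split => // [t|t t0]; first exact: expR_ge0.
rewrite /= -expR0 ler_expR -N0 -subr_ge0.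
have h := @mean_value_le R R (cst 0) N (cst 0) (fun u => 2 * M u) 0 t t0
  (fun u _ => is_derive_cst 0 u 1) (fun u _ => hN u).
by apply: le_trans (normr_ge0 _) (h _) => u _; rewrite /= normr0 mulr_ge0.
Qed.

Section cauchy_lipschitz.
Context {R : realType} {H : completeNormedModType R}.
Variables (G : R -> H -> H) (L : R -> R).
Hypothesis Lc : continuous L.
Hypothesis GL : forall t y1 y2, `|G t y1 - G t y2| <= L t * `|y1 - y2|.
Hypothesis Gc : forall x : R -> H, continuous x -> continuous (fun t => G t (x t)).

Lemma picard_lipschitz_le t y1 y2 w : `|y1 - y2| <= w ->
  `|G t y1 - G t y2| <= `|L t| * w.
Proof.
move=> yw; apply: le_trans (GL t y1 y2) _.
apply: le_trans (ler_wpM2r (normr_ge0 _) (ler_norm _)) _.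
by rewrite ler_wpM2l.
Qed.

Lemma picard_iterates (x0 : H) : exists X : nat -> R -> H,
  [/\ X 0%N = cst x0, forall k, X k 0 = x0, forall k, continuous (X k) &
    forall k (t : R), is_derive t 1 (X k.+1) (G t (X k t))].
Proof.
(* Placing the continuity of [x] inside the existential makes the Picard map total, as the axiom of
   choice requires; for discontinuous [x] the condition is vacuous. *)
have /choice[S hS] (x : R -> H) : exists y : R -> H, continuous x ->
    y 0 = x0 /\ forall t : R, is_derive t 1 y (G t (x t)).
  have [xc|nxc] := pselect (continuous x); last by exists x.
  have [F F0 hF] := antiderivative (Gc xc).
  exists (cst x0 + F) => _; split; first by rewrite fctE F0 addr0.
  by move=> t; rewrite -[G _ _]add0r; apply: is_deriveD.
pose X k := iter k S (cst x0).
have Xc k : continuous (X k).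
  elim: k => [|k Xc] t; first exact: cvg_cst.
  exact: is_derive_continuous ((hS _ Xc).2 t).
exists X; split => // [[|k] // | k t]; last exact: (hS _ (Xc k)).2.
exact: (hS _ (Xc k)).1.
Qed.

(** The summand [|G t x0|] of the rate, with [W >= 1], bounds the first step. The summand [|L t|]
    handles the others: the derivative of the next difference is at most [|L| * 2^-k * W], which is
    below the derivative of [2^-(k+1) * W]. *)
Lemma picard_contraction (x0 : H) (X : nat -> R -> H) (W : R -> R) :
  X 0%N = cst x0 -> (forall k, X k 0 = x0) ->
  (forall k (t : R), is_derive t 1 (X k.+1) (G t (X k t))) ->
  (forall t, 0 <= W t) -> (forall t, 0 <= t -> 1 <= W t) ->
  (forall t : R, is_derive t 1 W (2 * (`|L t| + `|G t x0|) * W t)) ->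
  forall k t, 0 <= t -> `|X k.+1 t - X k t| <= 2^-1 ^+ k * W t.
Proof.
move=> X0 Xinit dX W0 W1 dW k.
have dWZ (c : R) (t : R) : is_derive t 1 (c \*: W) (c * (2 * (`|L t| + `|G t x0|) * W t)).
  exact: is_deriveZ.
elim: k => [|k IH] t t0.
  rewrite expr0 mul1r; apply: le_trans (_ : W t - W 0 <= _); last by rewrite lerBlDr lerDl.
  have -> : X 1%N t - X 0%N t = X 1%N t - X 1%N 0 by rewrite X0 Xinit.
  apply: (mean_value_le t0 (fun u _ => dX 0%N u) (fun u _ => dW u)) => u /andP[u0 _].
  rewrite X0 /=.
  have := W1 u u0; have := normr_ge0 (L u); have := normr_ge0 (G u x0).
  move: `|L u| `|G u x0| (W u) => a b w; nra.
apply: le_trans (_ : 2^-1 ^+ k.+1 * W t - 2^-1 ^+ k.+1 * W 0 <= _); last first.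
  by rewrite lerBlDr lerDl mulr_ge0 ?exprn_ge0//; lra.
have -> : X k.+2 t - X k.+1 t = (X k.+2 - X k.+1) t - (X k.+2 - X k.+1) 0.
  by rewrite !fctE !Xinit subrr subr0.
apply: (mean_value_le t0 (fun u _ => is_deriveB (dX k.+1 u) (dX k u))
  (fun u _ => dWZ (2^-1 ^+ k.+1) u)) => u /andP[u0 _].
apply: le_trans (picard_lipschitz_le u (IH u u0)) _.
have k0 : 0 <= (2^-1 : R) ^+ k by rewrite exprn_ge0//; lra.
rewrite exprS; have := W0 u; have := normr_ge0 (L u); have := normr_ge0 (G u x0).
move: k0; move: (2^-1 ^+ k : R) `|L u| `|G u x0| (W u) => q a b w q0 b0 a0 w0.
have -> : 2^-1 * q * (2 * (a + b) * w) = (a + b) * (q * w) by field.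
by rewrite ler_wpM2r ?mulr_ge0// lerDl.
Qed.

(** The weight controls the iterates for [t >= 0] only, so the equation is claimed there, while [x]
    has the continuous derivative [v] on the whole line; this later gives absolute continuity. *)
Lemma cauchy_lipschitz_exists (x0 : H) : exists x v : R -> H,
  [/\ x 0 = x0, continuous v, forall t : R, is_derive t 1 x (v t) &
    forall t, 0 <= t -> v t = G t (x t)].
Proof.
have [X [X0 Xinit Xc dX]] := picard_iterates x0.
have [||W [W0 W1 dW]] := @picard_weight R (fun t => `|L t| + `|G t x0|).
- move=> t; apply: cvgD; apply: cvg_norm; first exact: Lc.
  by apply: (Gc (x := cst x0)) => ?; exact: cvg_cst.
- by move=> t; rewrite addr_ge0.
have step := picard_contraction X0 Xinit dX W0 W1 dW.
(* The coefficient is the geometric sum of [2^-i] for [k <= i < k + j]. *)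
have tail k j t : 0 <= t ->
    `|X (k + j)%N t - X k t| <= 2 * (2^-1 ^+ k - 2^-1 ^+ (k + j)) * W t.
  move=> t0; elim: j => [|j IH]; first by rewrite addn0 !subrr normr0 mulr0 mul0r.
  have -> : X (k + j.+1)%N t - X k t =
      (X (k + j).+1 t - X (k + j)%N t) + (X (k + j)%N t - X k t).
    by rewrite addrA subrK addnS.
  apply: le_trans (ler_normD _ _) _.
  apply: le_trans (lerD (step (k + j)%N t t0) IH) _.
  by rewrite addnS exprS; move: (2^-1 ^+ k) (2^-1 ^+ (k + j)) => p q; lra.
have {step} tail k n t : (k <= n)%N -> 0 <= t ->
    `|X n t - X k t| <= 2 * W t * 2^-1 ^+ k.
  move=> kn t0; rewrite -(subnKC kn); apply: le_trans (tail _ _ _ t0) _.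
  rewrite mulrAC ler_wpM2l ?mulr_ge0//.
  by rewrite lerBlDr lerDl exprn_ge0//; lra.
(* Freezing negative times at 0 gives a limit [xi] on the whole line, as [Gc] and [antiderivative]
   require. *)
have m0 (t : R) : 0 <= Order.max 0 t by rewrite le_max lexx.
have /choice[xi hxi] t : exists l : H, (fun n => X n (Order.max 0 t)) @ \oo --> l.
  apply: cauchy_seq_cvg => e e0.
  have [N hN] := @geometric_le R (2 * W (Order.max 0 t)) (e / 2)
    ltac:(by rewrite mulr_ge0) ltac:(lra).
  exists N => n m Nn Nm.
  have := hN N (leqnn N).
  have := tail N n _ Nn (m0 t); have := tail N m _ Nm (m0 t).
  have -> : X n (Order.max 0 t) - X m (Order.max 0 t) =
    (X n (Order.max 0 t) - X N (Order.max 0 t)) -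
    (X m (Order.max 0 t) - X N (Order.max 0 t)) by rewrite subrACA subrr subr0.
  move=> h1 h2 h3; apply: le_trans (ler_normB _ _) _; lra.
have xiX k t : `|xi t - X k (Order.max 0 t)| <=
    2 * W (Order.max 0 t) * 2^-1 ^+ k.
  by apply: (cvg_dist_le (N := k) (hxi t)) => n kn; exact: tail.
have maxc := @continuous_max0 R.
have Wc : continuous W by move=> t; exact: is_derive_continuous (dW t).
(* Near [c] the weight exceeds its value at [max 0 c] by at most 1, so a single [k] works in the
   three-term estimate. *)
have xic : continuous xi.
  move=> c; apply/cvgrPdist_le => e e0.
  have /cvgrPdist_le/(_ 1 ltr01) hW : {for c, continuous (W \o Order.max 0)}.
    by apply: continuous_comp; [exact: maxc | exact: Wc].
  have B0 : 0 <= 2 * (W (Order.max 0 c) + 1) by rewrite mulr_ge0// addr_ge0.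
  have e3 : 0 < e / 3 by lra.
  have [k /(_ k (leqnn k)) hk] := geometric_le B0 e3.
  have /cvgrPdist_le/(_ _ e3) hX :
      {for c, continuous (X k \o Order.max 0)}.
    by apply: continuous_comp; [exact: maxc | exact: Xc].
  near=> t.
  have hWt : `|W (Order.max 0 c) - W (Order.max 0 t)| <= 1 by near: t; exact: hW.
  have hXt : `|X k (Order.max 0 c) - X k (Order.max 0 t)| <= e / 3.
    by near: t; exact: hX.
  have hb u : W (Order.max 0 u) <= W (Order.max 0 c) + 1 ->
      `|xi u - X k (Order.max 0 u)| <= e / 3.
    move=> hu; apply: le_trans (xiX k u) _; apply: le_trans hk.
    by rewrite ler_wpM2r ?exprn_ge0 ?ler_wpM2l//; lra.
  have h1 : `|xi c - X k (Order.max 0 c)| <= e / 3 by apply: hb; lra.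
  have h2 : `|xi t - X k (Order.max 0 t)| <= e / 3.
    by apply: hb; move: hWt; rewrite ler_distl; lra.
  have -> : xi c - xi t = (xi c - X k (Order.max 0 c)) +
      (X k (Order.max 0 c) - X k (Order.max 0 t)) - (xi t - X k (Order.max 0 t)).
    by rewrite opprB !addrA !subrK.
  apply: le_trans (ler_normB _ _) _.
  apply: le_trans (lerD (ler_normD _ _) (lexx _)) _; lra.
(* [x] is the Picard image of [xi]. It is shown below to be a limit of the same iterates, hence
   equal to [xi] for [t >= 0]. *)
have [F F0 hF] := antiderivative (Gc xic).
pose x := cst x0 + F.
have x0E : x 0 = x0 by rewrite /x fctE F0 addr0.
have dx (t : R) : is_derive t 1 x (G t (xi t)).
  by rewrite -[G _ _]add0r; apply: is_deriveD.
exists x, (fun t => G t (xi t)); split => //; first exact: Gc.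
have max0 (t : R) : 0 <= t -> Order.max 0 t = t by move=> t0; rewrite max_r.
have xX k t : 0 <= t -> `|x t - X k.+1 t| <= 2^-1 ^+ k * W t.
  move=> t0.
  apply: le_trans (_ : 2^-1 ^+ k * W t - 2^-1 ^+ k * W 0 <= _); last first.
    by rewrite lerBlDr lerDl mulr_ge0 ?exprn_ge0//; lra.
  have -> : x t - X k.+1 t = (x - X k.+1) t - (x - X k.+1) 0.
    by rewrite !fctE -/(x 0) x0E Xinit subrr subr0.
  have dWZ (c u : R) :
      is_derive u 1 (c \*: W) (c * (2 * (`|L u| + `|G u x0|) * W u)).
    exact: is_deriveZ.
  apply: (mean_value_le t0 (fun u _ => is_deriveB (dx u) (dX k u))
    (fun u _ => dWZ (2^-1 ^+ k) u)) => u /andP[u0 _].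
  have := xiX k u; rewrite max0// => hu.
  apply: le_trans (picard_lipschitz_le u hu) _.
  have k0 : 0 <= (2^-1 : R) ^+ k by rewrite exprn_ge0//; lra.
  have := W0 u; have := normr_ge0 (L u); have := normr_ge0 (G u x0).
  move: k0; move: (2^-1 ^+ k : R) `|L u| `|G u x0| (W u) => q a b w q0 b0 a0 w0.
  have -> : q * (2 * (a + b) * w) = (a + b) * (2 * w * q) by ring.
  by rewrite ler_wpM2r ?mulr_ge0// lerDl.
move=> t t0; congr G; apply/eqP; rewrite eq_sym -subr_eq0 -normr_le0.
apply/ler_addgt0Pr => e e0; rewrite add0r.
have [N hN] := @geometric_le R (2 * W t) (e / 2) ltac:(by rewrite mulr_ge0) ltac:(lra).
have := hN N (leqnn N); have := hN N.+1 (leqnSn N).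
have := xX N t t0; have := xiX N.+1 t; rewrite max0// => h1 h2 h3 h4.
have -> : x t - xi t = (x t - X N.+1 t) - (xi t - X N.+1 t).
  by rewrite subrACA subrr subr0.
apply: le_trans (ler_normB _ _) _.
have : 0 <= 2^-1 ^+ N * W t by rewrite mulr_ge0// exprn_ge0//; lra.
lra.
Unshelve. all: by end_near.
Qed.

End cauchy_lipschitz.

(** * Absolute continuity, uniqueness and existence of strong solutions *)

Section absolute_continuity.
Context {R : realType} {V : normedModType R}.
Implicit Types x y : R -> V.

Lemma abs_cont_onS x a b c : c <= b -> abs_cont_on x a b -> abs_cont_on x a c.
Proof.
move=> cb xac e e0; have [d d0 hd] := xac e e0; exists d => // n s t hst.
by apply: hd => i; have [? [? ?]] := hst i; do !split => //; exact: le_trans cb.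
Qed.

Lemma abs_cont_onB x y a b :
  abs_cont_on x a b -> abs_cont_on y a b -> abs_cont_on (x - y) a b.
Proof.
move=> xac yac e e0; have e2 : 0 < e / 2 by lra.
have [d1 d10 hd1] := xac _ e2; have [d2 d20 hd2] := yac _ e2.
exists (Order.min d1 d2); first by rewrite lt_min d10.
move=> n s t hst hdis; rewrite lt_min => /andP[h1 h2].
have {}h1 := hd1 n s t hst hdis h1; have {}h2 := hd2 n s t hst hdis h2.
apply: (@le_lt_trans _ _ (\sum_(i < n) `|x (t i) - x (s i)| +
    \sum_(i < n) `|y (t i) - y (s i)|)); last lra.
rewrite -big_split /=; apply: ler_sum => i _.
by rewrite !fctE subrACA ler_normB.
Qed.

(** A single interval shorter than [d] changes [x] by less than 1, so the continuous induction
    proceeds with the same radius [d / 2] at every point. *)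
Lemma abs_cont_on_bounded x a b : a <= b -> abs_cont_on x a b ->
  exists2 B, 0 <= B & forall t, a <= t -> t <= b -> `|x t| <= B.
Proof.
move=> ab xac; have [d d0 hd] := xac 1 ltr01.
have close s t : a <= s -> s <= t -> t <= b -> t - s < d -> `|x t - x s| < 1.
  move=> as_ st tb tsd.
  have := hd 1%N (fun=> s) (fun=> t); rewrite !big_ord1; apply => //.
  by move=> i j; rewrite !ord1.
pose Q c := exists2 B, 0 <= B & forall t, a <= t -> t <= c -> `|x t| <= B.
apply: (@continuous_induction _ Q a b) => //.
  by exists `|x a| => // t h1 h2; have -> : t = a by lra.
move=> c acb; exists (d / 2); first lra.
move=> s t s0 sc ct tb cs td [B B0 hB]; exists (B + 1); first lra.
move=> u au ut; have [us|su] := leP u s; first by have := hB u au us; lra.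
have := close s u s0 (ltW su) (le_trans ut tb) ltac:(lra).
have := hB s s0 (lexx s).
have -> : x u = (x u - x s) + x s by rewrite subrK.
by move=> h1; rewrite addrK => h2; apply: le_trans (ler_normD _ _) _; lra.
Qed.

(** The maximum [K] of the norm of [v] on [[a, b]] is a Lipschitz constant of [x] there. *)
Lemma derivable_abs_cont_on x v (a b : R) : a <= b -> continuous v ->
  (forall t : R, is_derive t 1 x (v t)) -> abs_cont_on x a b.
Proof.
move=> ab vc dx.
have [|c cab hc] := @EVT_max R (fun t => `|v t|) a b ab.
  by apply: continuous_subspaceT => t; apply: cvg_norm; exact: vc.
pose K := `|v c|.
have lip s t : a <= s -> s <= t -> t <= b -> `|x t - x s| <= K * (t - s).
  move=> as_ st tb.
  have dK (u : R) : is_derive u 1 (K \*: (id : R -> R)) (K * 1).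
    by apply: is_deriveZ; exact: is_derive_id.
  rewrite mulrBr.
  apply: (mean_value_le st (fun u _ => dx u) (fun u _ => dK u)) => u /andP[su ut].
  by rewrite mulr1; apply: hc; rewrite in_itv /=; lra.
have K1 : 0 < K + 1 by have := normr_ge0 (v c); rewrite -/K; lra.
move=> e e0; exists (e / (K + 1)); first by rewrite divr_gt0.
move=> n s t hst _; rewrite ltr_pdivlMr//; apply: le_lt_trans.
rewrite mulr_suml; apply: ler_sum => i _; have [h1 [h2 h3]] := hst i.
apply: le_trans (lip _ _ h1 h2 h3) _.
by rewrite mulrC ler_wpM2l ?subr_ge0// lerDl.
Qed.

End absolute_continuity.

(** Allows coefficients given on the half-line to be replaced by extensions to the whole line. *)
Lemma eq_strong_global_solution (R : realType) (H : normedModType R)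
    (G G' : R -> H -> H) (x0 : H) (x : R -> H) :
  (forall t y, 0 <= t -> G t y = G' t y) ->
  strong_global_solution G x0 x -> strong_global_solution G' x0 x.
Proof.
move=> GG' [xac xae xx0]; split => //.
have aeF := ae_filter_ringOfSetsType (@lebesgue_measure R).
by apply: (@filterS _ _ aeF) xae => t h t0; rewrite -GG'//; exact: h.
Qed.

(** The difference [z] is bounded on [[0, T]] by some [B], hence by [B * W]; each use of the
    almost-everywhere mean value inequality halves this bound, and [k] tends to infinity. *)
Lemma strong_global_solution_unique (R : realType) (H : normedModType R)
    (G : R -> H -> H) (L : R -> R) (x0 : H) (x y : R -> H) :
  continuous L ->
  (forall t y1 y2, `|G t y1 - G t y2| <= L t * `|y1 - y2|) ->
  strong_global_solution G x0 x -> strong_global_solution G x0 y ->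
  forall t, 0 <= t -> x t = y t.
Proof.
move=> Lc GL [xac xae xx0] [yac yae yx0] T T0.
have [||W [W0 W1 dW]] := @picard_weight R (fun t => `|L t|).
- by move=> t; apply: cvg_norm; exact: Lc.
- by move=> t.
pose z := x - y.
have zac : abs_cont_on z 0 T by apply: abs_cont_onB; [exact: xac | exact: yac].
have [B B0 hB] := abs_cont_on_bounded T0 zac.
have contr k t : 0 <= t -> t <= T -> `|z t| <= B * 2^-1 ^+ k * W t.
  elim: k t => [|k IH] t t0 tT.
    rewrite expr0 mulr1; apply: le_trans (hB t t0 tT) _.
    by rewrite -[leLHS]mulr1 ler_wpM2l// W1.
  pose q := B * 2^-1 ^+ k.
  have q0 : 0 <= q by rewrite mulr_ge0// exprn_ge0//; lra.
  have -> : B * 2^-1 ^+ k.+1 = q / 2 by rewrite exprS mulrCA mulrC.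
  have -> : z t = z t - z 0 by rewrite /z !fctE xx0 yx0 subrr subr0.
  apply: le_trans (_ : q / 2 * W t - q / 2 * W 0 <= _); last first.
    by rewrite lerBlDr lerDl mulr_ge0//; lra.
  (* The derivative of [q / 2 * W] is [|L| * (q * W)], exactly the Lipschitz bound on the derivative
     of [z] under the induction hypothesis. *)
  apply: (@mean_value_ae_le R H z ((q / 2) \*: W)
      (fun u => q / 2 * (2 * `|L u| * W u)) t t0).
  - exact: abs_cont_onS zac.
  - by move=> u _; rewrite !mulr_ge0//; lra.
  - have aeF := ae_filter_ringOfSetsType (@lebesgue_measure R).
    apply: (@filterS2 _ _ aeF) xae yae => u hx hy /andP[u0 ut].
    have [dx ex] := hx u0; have [dy ey] := hy u0.
    split; first exact: derivableB.
    rewrite deriveB// ex ey; apply: le_trans (GL _ _ _) _.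
    have -> : q / 2 * (2 * `|L u| * W u) = `|L u| * (q * W u) by field.
    apply: le_trans (ler_wpM2r (normr_ge0 _) (ler_norm _)) _.
    by rewrite ler_wpM2l//; apply: (IH u u0); exact: le_trans tT.
apply/eqP; rewrite -subr_eq0 -normr_le0; apply/ler_addgt0Pr => e e0; rewrite add0r.
have [N hN] := @geometric_le R (B * W T) e ltac:(by rewrite mulr_ge0) e0.
by apply: le_trans (contr N T T0 (lexx T)) _; rewrite mulrAC; exact: hN.
Qed.

Lemma strong_global_solution_exists (R : realType) (H : completeNormedModType R)
    (G : R -> H -> H) (L : R -> R) (x0 : H) :
  continuous L ->
  (forall t y1 y2, `|G t y1 - G t y2| <= L t * `|y1 - y2|) ->
  (forall x : R -> H, continuous x -> continuous (fun t => G t (x t))) ->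
  exists x, strong_global_solution G x0 x.
Proof.
move=> Lc GL Gc; have [x [v [xx0 vc dx vG]]] := cauchy_lipschitz_exists Lc GL Gc x0.
exists x; split => // [T T0|]; first exact: derivable_abs_cont_on vc dx.
by apply: aeW => t t0; rewrite -vG//; have [? ?] := dx t.
Qed.

(** * Inner products and nonexpansiveness of the metric projection *)

Section projection.
Context {R : realType} {H : normedModType R} (ip : H -> H -> R).
Hypothesis Hip : inner_product ip.

Lemma ipDl x y z : ip (x + y) z = ip x z + ip y z.
Proof. by have := ip_linearl Hip 1 x y z; rewrite scale1r mul1r. Qed.

Lemma ip0l z : ip 0 z = 0.
Proof. by have := ipDl 0 0 z; rewrite addr0 => h; lra. Qed.

Lemma ipZl a x z : ip (a *: x) z = a * ip x z.
Proof. by have := ip_linearl Hip a x 0 z; rewrite addr0 ip0l addr0. Qed.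

Lemma ipNl x z : ip (- x) z = - ip x z.
Proof. by rewrite -scaleN1r ipZl mulN1r. Qed.

Lemma ipDr x y z : ip z (x + y) = ip z x + ip z y.
Proof. by rewrite !(ip_sym Hip z) ipDl. Qed.

Lemma ipZr a x z : ip z (a *: x) = a * ip z x.
Proof. by rewrite !(ip_sym Hip z) ipZl. Qed.

Lemma ipNr x z : ip z (- x) = - ip z x.
Proof. by rewrite !(ip_sym Hip z) ipNl. Qed.

Lemma norm_sqrB x y : `|x - y| ^+ 2 = `|x| ^+ 2 - 2 * ip x y + `|y| ^+ 2.
Proof.
rewrite !(ip_norm Hip) ipDl !ipDr !ipNl !ipNr (ip_sym Hip y x); lra.
Qed.

(** Expanding the square of the norm of [|y| x - |x| y] gives [2 |x| |y| (|x| |y| - ip x y)], which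
    is therefore nonnegative. *)
Lemma cauchy_schwarz x y : ip x y <= `|x| * `|y|.
Proof.
have [->|x0] := eqVneq x 0; first by rewrite ip0l normr0 mul0r.
have nx : 0 < `|x| by rewrite normr_gt0.
have := sqr_ge0 `|(`|y| *: x) - (`|x| *: y)|.
rewrite norm_sqrB ipZl ipZr !normrZ !normr_id => h.
have [->|y0] := eqVneq y 0; first by rewrite (ip_sym Hip) ip0l normr0 mulr0.
have ny : 0 < `|y| by rewrite normr_gt0.
rewrite -subr_ge0; have : 0 <= 2 * (`|x| * `|y|) * (`|x| * `|y| - ip x y) by lra.
by rewrite pmulr_rge0// !mulr_gt0.
Qed.

Variables (C : set H) (P : H -> H).
Hypothesis Cconv : convex_set C.
Hypothesis PC : metric_projection C P.

Lemma metric_projection_obtuse x y : C y -> ip (x - P x) (y - P x) <= 0.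
Proof.
move=> Cy; have [CPx Pmin] := PC x.
set u := x - P x; set v := y - P x.
(* The segment from [P x] to [y] stays in [C], so [|u|^2 <= |u - a v|^2]. *)
have key a : 0 < a -> a <= 1 -> 2 * ip u v <= a * `|v| ^+ 2.
  move=> a0 a1.
  have Ca : C (P x + a *: v).
    have := Cconv (Itv01 (ltW a0) a1) (mem_set Cy) (mem_set CPx).
    rewrite inE; congr C; rewrite /conv /= scalerBl scale1r scalerBr.
    by rewrite addrCA.
  have := Pmin _ Ca; rewrite opprD addrA -/u.
  rewrite -(ler_pXn2r (n := 2))// ?nnegrE// (norm_sqrB u (a *: v)) ipZr normrZ exprMn.
  rewrite (ger0_norm (ltW a0)) => h.
  by rewrite -(ler_pM2l a0); lra.
rewrite -(pmulr_rle0 _ (ltr0Sn R 1)); apply/ler_addgt0Pr => e e0; rewrite add0r.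
have v1 : 0 < `|v| ^+ 2 + 1 by rewrite ltr_wpDl// sqr_ge0.
(* The parameter [a = e / (|v|^2 + 1)] makes [a |v|^2] at most [e]; if it exceeds 1, then
   [|v|^2 < e] already and [a = 1] suffices. *)
have [h|h] := leP (e / (`|v| ^+ 2 + 1)) 1.
  apply: le_trans (key _ (divr_gt0 e0 v1) h) _.
  by rewrite mulrAC ler_pdivrMr// ler_wpM2l//; lra.
apply: le_trans (key 1 ltr01 (lexx _)) _.
move: h; rewrite ltr_pdivlMr// !mul1r; lra.
Qed.

(** Adding the obtuse-angle inequalities at [x] against [P y] and at [y] against [P x] gives firm
    nonexpansiveness; Cauchy-Schwarz then allows division by [|P x - P y|]. *)
Lemma metric_projection_nonexpansive x y : `|P x - P y| <= `|x - y|.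
Proof.
have [CPx _] := PC x; have [CPy _] := PC y.
have h1 := metric_projection_obtuse x CPy.
have h2 := metric_projection_obtuse y CPx.
have h : `|P x - P y| ^+ 2 <= ip (x - y) (P x - P y).
  rewrite (ip_norm Hip); move: h1 h2.
  by rewrite !(ipDl, ipDr, ipNl, ipNr); lra.
have {h} := le_trans h (cauchy_schwarz _ _).
have [->|PP] := eqVneq (P x - P y) 0; first by rewrite normr0.
by rewrite expr2 ler_pM2r// normr_gt0.
Qed.

End projection.

(** * The projected vector field and its regularity *)

Lemma lipschitz_with_continuous (R : realType) (H : normedModType R) (K : R)
    (f : H -> H) :
  lipschitz_with K f -> continuous f.
Proof.
move=> fK c; apply/cvgrPdist_le => e e0.
have K1 : 0 < `|K| + 1 by have := normr_ge0 K; lra.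
apply/nbhs_ballP; exists (e / (`|K| + 1)); first by rewrite /= divr_gt0.
move=> y; rewrite -ball_normE /= ltr_pdivlMr// => cy.
apply: le_trans (fK c y) _; apply: le_trans (ltW cy); rewrite mulrC ler_wpM2l//.
by have := ler_norm K; lra.
Qed.

(** Composing with [max 0] extends a function continuous on the half-line by its value at 0. *)
Lemma within_continuous_comp_max0 (R : realType) (f : R -> R) :
  {within [set t : R | 0 <= t], continuous f} ->
  continuous (fun t : R => f (Order.max 0 t)).
Proof.
move=> /subspace_continuousP fc c.
have m0 (t : R) : 0 <= Order.max 0 t by rewrite le_max lexx.
apply: (@cvg_comp _ _ _ (Order.max 0) f _
  (within [set t : R | 0 <= t] (nbhs (Order.max 0 c)))); last exact: fc (m0 c).
move=> U /(@continuous_max0 R c).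
by apply: (@filterS _ (nbhs c)) => t /= h; exact: h (m0 t).
Qed.

Section projected_field.
Context {R : realType} {H : normedModType R}.
Variables (P A F : H -> H) (LA LF : R) (alpha mu : R -> R).
Hypothesis P1 : forall x y, `|P x - P y| <= `|x - y|.
Hypothesis AL : lipschitz_with LA A.
Hypothesis FL : lipschitz_with LF F.

Definition projected_field t (y : H) :=
  P ((F y + alpha t *: y) - mu t *: A y) - (F y + alpha t *: y).

(** The term [F y + alpha t *: y] occurs inside and outside [P], whence the factor 2; the term with
    [A] occurs once. *)
Lemma projected_field_lipschitz t y1 y2 :
  `|projected_field t y1 - projected_field t y2| <=
  (2 * (LF + `|alpha t|) + `|mu t| * LA) * `|y1 - y2|.
Proof.
rewrite /projected_field subrACA.
set b1 := F y1 + _; set b2 := F y2 + _.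
have hb : `|b1 - b2| <= (LF + `|alpha t|) * `|y1 - y2|.
  rewrite /b1 /b2 opprD addrACA -scalerBr.
  apply: le_trans (ler_normD _ _) _; rewrite mulrDl normrZ.
  by rewrite lerD2r; exact: FL.
have hA : `|mu t *: A y1 - mu t *: A y2| <= `|mu t| * LA * `|y1 - y2|.
  by rewrite -scalerBr normrZ -mulrA ler_wpM2l//; exact: AL.
apply: le_trans (ler_normB _ _) _.
apply: le_trans (lerD (P1 _ _) (lexx _)) _.
rewrite subrACA; apply: le_trans (lerD (ler_normB _ _) (lexx _)) _.
move: hb hA; lra.
Qed.

Lemma projected_field_continuous (x : R -> H) :
  continuous alpha -> continuous mu -> continuous x ->
  continuous (fun t => projected_field t (x t)).
Proof.
move=> ac mc xc t.
have Pc : continuous P.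
  by apply: (@lipschitz_with_continuous _ _ 1) => a b; rewrite mul1r.
have hF : {for t, continuous (fun u => F (x u) + alpha u *: x u)}.
  apply: cvgD; last by apply: cvgZ; [exact: ac | exact: xc].
  apply: (@continuous_comp _ _ _ x F); first exact: xc.
  exact: lipschitz_with_continuous FL _.
apply: cvgB => //.
apply: (@continuous_comp _ _ _
  (fun u => F (x u) + alpha u *: x u - mu u *: A (x u)) P); last exact: Pc.
apply: cvgB => //; apply: cvgZ; first exact: mc.
apply: (@continuous_comp _ _ _ x A); first exact: xc.
exact: lipschitz_with_continuous AL _.
Qed.

End projected_field.

(** * Well-posedness of the projected dynamical system *)

Unset Implicit Arguments.
Set Strict Implicit.

Theorem theorem3p3 (R : realType) (H : completeNormedModType R)
  (ip : H -> H -> R) (Hip : inner_product ip)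
  (C : set H) (P : H -> H) (A F : H -> H) (lam LA LF : R)
  (alpha mu : R -> R) :
  C !=set0 -> closed C -> convex_set C -> metric_projection C P ->
  (* (A1) *)
  0 < lam -> strongly_monotone ip lam A -> lipschitz_with LA A ->
  lipschitz_with LF F ->
  seq_weak_weak_continuous ip A -> seq_weak_weak_continuous ip F ->
  (* (A2) *)
  couple_monotone ip A F ->
  (* (A3) *)
  GVI_sol ip A F C !=set0 -> convex_set (A @` GVI_sol ip A F C) ->
  {within [set t : R | 0 <= t], continuous alpha} ->
  {within [set t : R | 0 <= t], continuous mu} ->
  (forall t, 0 <= t -> 0 < alpha t) -> (forall t, 0 <= t -> 0 < mu t) ->
  forall x0 : H,
    let G := fun t (y : H) =>
      P ((F y + alpha t *: y) - mu t *: A y) - (F y + alpha t *: y) in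
    (exists x : R -> H, strong_global_solution G x0 x) /\
    (forall x y : R -> H, strong_global_solution G x0 x ->
       strong_global_solution G x0 y -> forall t, 0 <= t -> x t = y t).
Proof.
move=> _ _ Cconv PC _ _ AL FL _ _ _ _ _ alphac muc _ _ x0 G.
have P1 := metric_projection_nonexpansive Hip Cconv PC.
(* The extended coefficients are continuous on the whole line, where the Picard argument runs; the
   two fields agree for [t >= 0], so they have the same strong solutions. *)
pose al t := alpha (Order.max 0 t); pose m t := mu (Order.max 0 t).
have alc : continuous al by exact: within_continuous_comp_max0.
have mc : continuous m by exact: within_continuous_comp_max0.
pose G' := projected_field P A F al m.
have GG' t y : 0 <= t -> G t y = G' t y.
  by move=> t0; rewrite /G /G' /projected_field /al /m max_r.
have Lc : continuous (fun t => 2 * (LF + `|al t|) + `|m t| * LA).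
  move=> t; apply: cvgD.
    apply: cvgM; first exact: cvg_cst.
    by apply: cvgD; [exact: cvg_cst | apply: cvg_norm; exact: alc].
  by apply: cvgM; [apply: cvg_norm; exact: mc | exact: cvg_cst].
have GL := projected_field_lipschitz al m P1 AL FL.
split=> [|x y xs ys].
  have Gc x := projected_field_continuous P1 AL FL (x := x) alc mc.
  have [x xs] := strong_global_solution_exists x0 Lc GL Gc.
  by exists x; apply: eq_strong_global_solution xs => t y t0; rewrite GG'.
by apply: (strong_global_solution_unique Lc GL (x0 := x0));
  exact: eq_strong_global_solution GG' _.
Qed.
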